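(* Let $p\ge19$ be prime, $0<\alpha<1$, and $\alpha^{e^{-132}}\le\beta\le\min(p^{-\log p},p^{-100})$. Then there exist $n\ge\mathrm{Tow}\!\left(p,\tfrac{1}{20}(\log p)\ln\!\big(\tfrac{\log(1/\alpha)}{\log(1/\beta)}\big),1/\beta\right)$ and a function $f:\mathbb{F}_p^n\to[0,1]$ with $\mathbb{E}_{x}[f(x)]=\alpha$ such that for every nonzero $d\in\mathbb{F}_p^n$, $\mathbb{E}_{x\in\mathbb{F}_p^n}[f(x)f(x+d)f(x+2d)]<\beta\alpha^3$.
   Context: $\mathrm{Tow}(a,0,r)=r$, $\mathrm{Tow}(a,k+1,r)=a^{\mathrm{Tow}(a,k,r)}$, non-integer heights rounded down. $\log$ is base 2, $\ln$ natural. *)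

(* Defs.v *)
From mathcomp Require Import all_boot all_order all_algebra.
From Stdlib Require Import Reals.
Set Implicit Arguments. Unset Strict Implicit. Unset Printing Implicit Defensive.

Definition log2 (x : R) : R := (ln x / ln 2)%R.

Fixpoint Tow (a : R) (k : nat) (r : R) : R :=
  match k with
  | O => r
  | S k' => Rpower a (Tow a k' r)
  end.

(* non-integer heights rounded down: floor (Int_part is floor in Stdlib) *)
Definition TowR (a h r : R) : R := Tow a (Z.to_nat (Int_part h)) r.

Definition Ex (p n : nat) (g : 'rV['F_p]_n -> R) : R :=
  (\big[Rplus/0%R]_(x : 'rV['F_p]_n) g x / INR #|{: 'rV['F_p]_n}|)%R.

(* Main.v *)
From HB Require Import structures.
From Stdlib Require Import ZArith Reals Lra.
Require Import Defs.
From mathcomp Require Import all_boot all_order all_algebra.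
From mathcomp Require Import zify.
From mathcomp Require ring.
Set Implicit Arguments. Unset Strict Implicit. Unset Printing Implicit Defensive.

(** Work with sets S instead of functions: if S has density sigma >= alpha, take f = (alpha / sigma) 1_S.
    Start from a Behrend-type progression-free set S in F_p^n. Given S and a progression-free set A in F_p^k,
    choose for every x a random linear map M_x : F_p^m -> F_p^k and pass to
    S' = {(x, y) : x in S, M_x y in A}. For d = (d1, d2) with d1 <> 0 the maps at x, x + d1, x + 2 d1 are jointly onto,
    so the relative density of progressions does not change. For d1 = 0 the fibre over x contains
    no progression unless M_x d2 = 0, which happens for a fraction O(p^-k) of x in S, even uniformly
    over all d2 when m is of order |S| p^-k. So the dimension grows exponentially while log(1/sigma) only grows
    by a factor 1 + O(1 / log p), which allows about (log p) ln(log(1/alpha) / log(1/beta)) steps. *)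

(* Stdlib's reals and MathComp's rings both claim the key [R]. *)
Delimit Scope ring_scope with ring.
Delimit Scope R_scope with R.

HB.saturate finfun_of.

(** * Fibres of surjective additive maps between finite groups *)

Section Counting.
Import GRing.Theory ring.
Local Open Scope ring_scope.

Definition ap_set (V : finZmodType) (S : {set V}) (d : V) : {set V} :=
  [set x | [&& x \in S, x + d \in S & x + d *+ 2 \in S]].

(** All fibres are translates of the kernel and share one size [c]; the full target gives
    [#|U| = #|V| * c]. Eliminating [c] keeps the identity free of division. *)
Lemma card_preim_surj (U V : finZmodType) (f : U -> V) (B : {set V}) :
  {morph f : x y / x + y} -> (forall v, exists u, f u = v) ->
  (#|[set u | f u \in B]| * #|V| = #|U| * #|B|)%N.
Proof.
move=> fD fsurj.
have f0 : f 0 = 0 by apply: (addIr (f 0)); rewrite -fD !add0r.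
have fN x : f (- x) = - f x by apply: (addIr (f x)); rewrite -fD !addNr.
pose c := #|[set u | f u == 0]|.
have fib v : #|[set u | f u == v]| = c.
  have [w fw] := fsurj v.
  rewrite /c -(card_imset [set u | f u == 0] (addrI w)); apply: eq_card => u.
  rewrite inE; apply/eqP/imsetP => [fu|[u0]].
    by exists (u - w); rewrite ?inE ?fD ?fN ?fu ?fw ?subrr //= addrC subrK.
  by rewrite inE => /eqP fu0 ->; rewrite fD fw fu0 addr0.
have key (C : {set V}) : (#|[set u | f u \in C]| = #|C| * c)%N.
  rewrite -sum1_card (partition_big f (mem C)) => [|u] /=; last by rewrite inE.
  rewrite -sum_nat_const; apply: eq_bigr => v vC; rewrite -(fib v) -sum1_card; apply: eq_bigl => u.
  by rewrite !inE; case: eqP => [->|_]; rewrite ?vC ?andbF.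
have -> : #|U| = #|[set u | f u \in [set: V]]|.
  by rewrite -cardsT; apply: eq_card => u; rewrite !inE.
by rewrite !key cardsT [RHS]mulnC (mulnC #|V|) mulnA.
Qed.

Lemma card_preim_mulmx (p m k : nat) (pr : prime p) (M : 'M['F_p]_(m, k)) (B : {set 'rV['F_p]_k}) :
  row_full M -> (#|[set y : 'rV_m | y *m M \in B]| * p ^ k = p ^ m * #|B|)%N.
Proof.
move=> Mfull.
have := @card_preim_surj 'rV['F_p]_m 'rV['F_p]_k (fun y => y *m M) B.
rewrite !card_mx !card_Fp // !mul1n => ->//; first by move=> x y; exact: mulmxDl.
move=> v.
have [N NM] := row_fullP Mfull.
by exists (v *m N); rewrite -mulmxA NM mulmx1.
Qed.

Lemma card_ann_row (p m k : nat) (pr : prime p) (d : 'rV['F_p]_m) : d != 0 ->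
  (#|[set A : 'M['F_p]_(m, k) | d *m A == 0%ring]| * p ^ k = p ^ (m * k))%N.
Proof.
move=> dn0.
have := @card_preim_surj 'M['F_p]_(m, k) 'rV['F_p]_k (fun A => d *m A) [set 0].
rewrite !card_mx !card_Fp // !mul1n cards1 muln1 => <-.
- by congr (_ * _)%N; apply: eq_card => A; rewrite !inE.
- by move=> x y; rewrite mulmxDr.
move=> v.
have [i di] : exists i, d 0 i != 0 by apply/rV0Pn.
(* Only row [i] is nonzero; it is [v] divided by the coordinate [d 0 i]. *)
exists (\matrix_(i', j) ((i' == i)%:R * (d 0 i)^-1 * v 0 j)).
apply/rowP => j; rewrite mxE (bigD1 i) //= mxE eqxx mul1r mulVKf //.
by rewrite big1 ?addr0 // => i' /negPf ne; rewrite mxE ne !mul0r mulr0.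
Qed.

(** The map is onto because some block of [v] is nonzero: as the three points are distinct, a family
    supported at the point of that block already reaches every value. Hence a fixed [v] is killed
    with probability [p ^ -m]. *)
Lemma card_triple_ann (p m k : nat) (X : finType) (pr : prime p) (x1 x2 x3 : X)
    (v : 'cV['F_p]_(k + (k + k))) :
  x1 != x2 -> x1 != x3 -> x2 != x3 -> v != 0 ->
  (#|[set M : {ffun X -> 'M['F_p]_(m, k)} |
      row_mx (M x1) (row_mx (M x2) (M x3)) *m v == 0%ring]| * p ^ m
    = #|{ffun X -> 'M['F_p]_(m, k)}|)%N.
Proof.
move=> n12 n13 n23 vn0.
pose f (M : {ffun X -> 'M['F_p]_(m, k)}) : 'cV['F_p]_m := row_mx (M x1) (row_mx (M x2) (M x3)) *m v.
have := @card_preim_surj {ffun X -> 'M['F_p]_(m, k)} 'cV['F_p]_m f [set 0].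
rewrite !card_mx !card_Fp // !muln1 cards1 muln1 => <-.
- by congr (_ * _)%N; apply: eq_card => A; rewrite !inE.
- by move=> M N; rewrite /f !ffunE -!add_row_mx mulmxDl.
move=> w.
have solve (u : 'cV['F_p]_k) : u != 0 -> exists A : 'M['F_p]_(m, k), A *m u = w.
  case/cV0Pn=> i ui.
  exists (\matrix_(j, i') ((i' == i)%:R * (u i 0)^-1 * w j 0)).
  apply/colP => j; rewrite mxE (bigD1 i) //= mxE eqxx mul1r mulrAC mulVf // mul1r.
  by rewrite big1 ?addr0 // => i' /negPf ne; rewrite mxE ne !mul0r.
pose v1 := usubmx v; pose v2 := usubmx (dsubmx v); pose v3 := dsubmx (dsubmx v).
have vE : v = col_mx v1 (col_mx v2 v3) by rewrite !vsubmxK.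
have fE M : f M = M x1 *m v1 + (M x2 *m v2 + M x3 *m v3).
  by rewrite /f vE !mul_row_col.
have [v10|/solve[A Au]] := eqVneq v1 0; last first.
  exists [ffun x => if x == x1 then A else 0].
  by rewrite fE !ffunE eqxx eq_sym (negPf n12) eq_sym (negPf n13) !mul0mx !addr0.
have [v20|/solve[A Au]] := eqVneq v2 0; last first.
  exists [ffun x => if x == x2 then A else 0].
  by rewrite fE !ffunE eqxx (negPf n12) [x3 == _]eq_sym (negPf n23) !mul0mx addr0 add0r.
have [v30|/solve[A Au]] := eqVneq v3 0; last first.
  exists [ffun x => if x == x3 then A else 0].
  by rewrite fE !ffunE eqxx (negPf n13) (negPf n23) !mul0mx !add0r.
by case/eqP: vn0; rewrite vE v10 v20 v30 !col_mx0.
Qed.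

(** * Random families of linear maps: exponential moment and union bound *)

Let leq_exp2r_wk (m n e : nat) : (m <= n -> m ^ e <= n ^ e)%N.
Proof. by case: e => [|e] mn; rewrite ?expn0 // leq_exp2r. Qed.

(** An integer form of [(1 + 1/K) ^ K <= 4]. Bernoulli's inequality bounds [(K / (K + 1)) ^ h] below
    by [1 - h / (K + 1)], which is at least [1/2] at [h = uphalf K]; squaring gives the factor 4. *)
Lemma expnS_self_le4 (K : nat) : ((K.+1) ^ K <= 4 * K ^ K)%N.
Proof.
have bern h : (h <= K.+1 -> K.+1 ^ h * (K.+1 - h) <= K ^ h * K.+1)%N.
  elim: h => [|h IH] hK; first by rewrite !expn0 !mul1n subn0.
  have /IH := ltnW hK; rewrite !expnS => {}IH.
  have -> : (K.+1 * K.+1 ^ h * (K.+1 - h.+1) = K.+1 ^ h * (K.+1 * (K - h)))%N by rewrite subSS; lia.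
  apply: leq_trans (_ : (K.+1 ^ h * (K * (K.+1 - h)) <= _)%N); first by rewrite leq_mul2l; apply/orP; right; nia.
  by rewrite mulnCA -mulnA leq_mul2l IH orbT.
have half : (K.+1 ^ (uphalf K) <= 2 * K ^ (uphalf K))%N.
  have hK : (uphalf K <= K.+1)%N by rewrite leq_uphalf_double -addnn; lia.
  have := bern _ hK; have : (2 * (K.+1 - uphalf K) >= K.+1)%N.
    by have := odd_double_half K.+1; rewrite -[uphalf K]/(K.+1./2) -mul2n; lia.
  set a := (K.+1 ^ _)%N; set b := (K ^ _)%N; set c := (K.+1 - _)%N; nia.
have sq : (K.+1 ^ (2 * uphalf K) <= 4 * K ^ (2 * uphalf K))%N.
  by rewrite mulnC !expnM -[4%N]/(2 ^ 2)%N -expnMn leq_exp2r.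
have [e|e] : (2 * uphalf K = K \/ 2 * uphalf K = K.+1)%N.
  by have := odd_double_half K.+1; rewrite -[uphalf K]/(K.+1./2) -mul2n; case: odd => /=; lia.
  by rewrite e in sq.
rewrite e !expnS in sq.
have [->//|K0] := posnP K.
move: sq; set a := (K.+1 ^ _)%N; set b := (K ^ _)%N; nia.
Qed.

Lemma expnS_le4 (K s J : nat) : (0 < K -> s <= J * K -> K.+1 ^ s <= 4 ^ J * K ^ s)%N.
Proof.
move=> K0 sJK.
rewrite -(@leq_pmul2r (K ^ (J * K - s))) ?expn_gt0 ?K0 // -mulnA -expnD subnKC //.
apply: leq_trans (_ : (K.+1 ^ (J * K) <= _)%N).
  by rewrite -[X in (_ <= _ ^ X)%N](subnKC sJK) expnD leq_mul2l leq_exp2r_wk ?orbT.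
by rewrite mulnC !expnM -expnMn; apply: leq_exp2r_wk; exact: expnS_self_le4.
Qed.

(* Markov's inequality for 2 ^ Z, where Z counts the x in S with d *m M x = 0: Z has mean |S| / p ^ k <= J. *)
Lemma card_many_zeros (p m k J : nat) (X : finType) (S : {set X}) (pr : prime p)
    (d : 'rV['F_p]_m) : d != 0 -> (#|S| <= J * p ^ k)%N ->
  (#|[set M : {ffun X -> 'M['F_p]_(m, k)} |
      4 * J <= #|[set x in S | d *m M x == 0%ring]|]| * 4 ^ J
    <= #|{ffun X -> 'M['F_p]_(m, k)}|)%N.
Proof.
move=> dn0 sJ; pose Om := {ffun X -> 'M['F_p]_(m, k)}.
pose Z (M : Om) := #|[set x in S | d *m M x == 0]|.
pose w x (A : 'M['F_p]_(m, k)) := (if (x \in S) && (d *m A == 0%ring) then 2 else 1)%N.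
pose c := #|[set A : 'M['F_p]_(m, k) | d *m A == 0%ring]|.
pose Q := (p ^ (m * k))%N; pose K := (p ^ k)%N.
have QE : Q = (c * K)%N by rewrite /Q -(card_ann_row k pr dn0).
have K0 : (0 < K)%N by rewrite expn_gt0 prime_gt0.
have ZE M : (2 ^ Z M = \prod_x w x (M x))%N.
  rewrite (bigID (fun x => (x \in S) && (d *m M x == 0))) /=.
  rewrite [X in (_ * X)%N]big1 ?muln1 => [|x /negPf nx]; last by rewrite /w nx.
  rewrite (eq_bigr (fun=> 2%N)) => [|x hx]; last by rewrite /w hx.
  by rewrite prod_nat_const; congr (_ ^ _)%N; apply: eq_card => x; rewrite inE.
have Qcard : #|{: 'M['F_p]_(m, k)}| = Q by rewrite card_mx card_Fp.
have wE x : (\sum_A w x A = if x \in S then c + Q else Q)%N.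
  rewrite /w; case: (x \in S) => /=; last by rewrite sum1_card.
  rewrite (eq_bigr (fun A : 'M['F_p]_(m, k) => (d *m A == 0%ring) + 1)%N) => [|A _]; last by case: eqP.
  by rewrite big_split /= sum1_card Qcard /c -sum1dep_card [in RHS]big_mkcond; congr (_ + _)%N; apply: eq_bigr => A _; case: eqP.
(* Independence: each factor of [2 ^ Z] depends on one [M x] only, so the sum over families becomes
   a product of sums over matrices. *)
have tot : (\sum_M 2 ^ Z M = (c + Q) ^ #|S| * Q ^ #|~: S|)%N.
  rewrite (eq_bigr _ (fun M _ => ZE M)) -(bigA_distr_bigA w) (bigID (mem S)) /=.
  rewrite (eq_bigr (fun=> (c + Q)%N)) => [|x xS]; last by rewrite wE xS.
  rewrite prod_nat_const (eq_bigr (fun=> Q)) => [|x /negPf xS]; last by rewrite wE xS.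
  by rewrite prod_nat_const; congr (_ * _ ^ _)%N; apply: eq_card => x; rewrite !inE.
have OmE : (#|Om| = Q ^ #|S| * Q ^ #|~: S|)%N.
  by rewrite card_ffun Qcard -expnD cardsC.
rewrite -(@leq_pmul2r (4 ^ J)) ?expn_gt0 // -mulnA.
apply: leq_trans (_ : (\sum_M 2 ^ Z M <= _)%N).
  (* On the event, [2 ^ Z] is at least [16 ^ J]; one factor [4 ^ J] absorbs the mean, the other is
     the gain. *)
  rewrite -expnMn -[(4 * 4)%N]/(2 ^ 4)%N -expnM -sum_nat_const [leqRHS](bigID (fun M : Om => 4 * J <= Z M)%N) /=.
  apply: leq_trans (leq_addr _ _).
  under eq_bigl do rewrite inE.
  by apply: leq_sum => M hM; rewrite leq_exp2l.
rewrite tot OmE mulnAC leq_mul2r; apply/orP; right.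
have -> : (c + Q = c * K.+1)%N by rewrite QE mulnS.
rewrite QE !expnMn -mulnA leq_mul2l; apply/orP; right.
by rewrite mulnC expnS_le4.
Qed.

(** Union bound: each requirement fails for less than half of the families. The first involves at
    most [p ^ m] vectors [d], each bad with probability at most [4 ^ -J]; the second at most
    [#|X| ^ 2 * p ^ (3 * k)] triples [(x, d, v)], each bad with probability [p ^ -m]. *)
Lemma exists_maps (p m k J : nat) (X : finZmodType) (S : {set X}) (pr : prime p) :
  (forall d : X, d != 0 -> d *+ 2 != 0) ->
  (#|S| <= J * p ^ k)%N -> (2 * p ^ m < 4 ^ J)%N ->
  (2 * #|X| ^ 2 * (p ^ k) ^ 3 < p ^ m)%N ->
  exists M : {ffun X -> 'M['F_p]_(m, k)},
    (forall d : 'rV_m, d != 0 -> (#|[set x in S | d *m M x == 0%ring]| < 4 * J)%N) /\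
    (forall x d : X, d != 0 -> row_full (row_mx (M x) (row_mx (M (x + d)) (M (x + d *+ 2))))).
Proof.
move=> X2 sJ mJ Nm; pose Om := {ffun X -> 'M['F_p]_(m, k)}.
pose bad1 (d : 'rV['F_p]_m) : {set Om} :=
  [set M : Om | 4 * J <= #|[set x in S | d *m M x == 0%ring]|]%N.
pose bad2 (u : X * X * 'cV['F_p]_(k + (k + k))) : {set Om} :=
  [set M : Om | row_mx (M u.1.1) (row_mx (M (u.1.1 + u.1.2)) (M (u.1.1 + u.1.2 *+ 2))) *m u.2 == 0].
pose D1 := [set d : 'rV['F_p]_m | d != 0].
pose D2 := [set u : X * X * 'cV['F_p]_(k + (k + k)) | (u.1.2 != 0) && (u.2 != 0)].
have Om0 : (0 < #|Om|)%N by rewrite card_ffun card_mx card_Fp // !expn_gt0 prime_gt0.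
have b1 d : d \in D1 -> (#|bad1 d| * 4 ^ J <= #|Om|)%N.
  by rewrite inE => dn0; exact: card_many_zeros.
have b2 u : u \in D2 -> (#|bad2 u| * p ^ m <= #|Om|)%N.
  rewrite inE => /andP[dn0 vn0].
  rewrite (@card_triple_ann p m k X pr u.1.1 (u.1.1 + u.1.2) (u.1.1 + u.1.2 *+ 2) u.2) //.
  - by rewrite -subr_eq0 opprD addNKr oppr_eq0.
  - by rewrite -subr_eq0 opprD addNKr oppr_eq0 X2.
  - by rewrite (inj_eq (addrI _)) mulr2n -subr_eq0 opprD addNKr oppr_eq0.
pose U1 := \bigcup_(d in D1) bad1 d; pose U2 := \bigcup_(u in D2) bad2 u.
have U1le : (2 * #|U1| < #|Om|)%N.
  have : (#|U1| * 4 ^ J <= p ^ m * #|Om|)%N.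
    apply: leq_trans (_ : (\sum_(d in D1) #|bad1 d| * 4 ^ J <= _)%N).
      rewrite -big_distrl /= leq_mul2r; apply/orP; right.
      by apply: (big_ind2 (fun (A : {set Om}) n => #|A| <= n)%N); rewrite ?cards0 // => A a B b Aa Bb;
        apply: leq_trans (leq_add Aa Bb); rewrite cardsU leq_subr.
    apply: leq_trans (leq_sum _ b1) _.
    rewrite sum_nat_const leq_mul2r; apply/orP; right.
    by rewrite (leq_trans (max_card _)) // card_mx card_Fp // mul1n.
  move: mJ Om0; set a := #|U1|; set b := #|Om|; set c := (4 ^ J)%N; set e := (p ^ m)%N => ? ? ?; nia.
have U2le : (2 * #|U2| < #|Om|)%N.
  have : (#|U2| * p ^ m <= #|X| ^ 2 * (p ^ k) ^ 3 * #|Om|)%N.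
    apply: leq_trans (_ : (\sum_(u in D2) #|bad2 u| * p ^ m <= _)%N).
      rewrite -big_distrl /= leq_mul2r; apply/orP; right.
      by apply: (big_ind2 (fun (A : {set Om}) n => #|A| <= n)%N); rewrite ?cards0 // => A a B b Aa Bb;
        apply: leq_trans (leq_add Aa Bb); rewrite cardsU leq_subr.
    apply: leq_trans (leq_sum _ b2) _.
    rewrite sum_nat_const leq_mul2r; apply/orP; right.
    rewrite (leq_trans (max_card _)) // !card_prod card_mx card_Fp // muln1.
    by rewrite -expnM mulnn (_ : k + (k + k) = k * 3)%N //; lia.
  move: Nm Om0; set a := #|U2|; set b := #|Om|; set c := (p ^ m)%N; rewrite -mulnA; set e := (_ * (p ^ k) ^ 3)%N.
  move=> ? ? ?; nia.
have [M MU] : exists M, M \notin U1 :|: U2.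
  apply/existsP; rewrite -negb_forall; apply/negP => /forallP all_in.
  have : (#|Om| <= #|U1| + #|U2|)%N.
    apply: leq_trans (_ : (#|U1 :|: U2| <= _)%N); last by rewrite cardsU leq_subr.
    by apply/subset_leq_card/subsetP => M _; apply: all_in.
  lia.
exists M; move: MU; rewrite in_setU negb_or => /andP[M1 M2]; split => [d dn0|x d dn0].
  rewrite ltnNge; apply: contra M1 => bad.
  by apply/bigcupP; exists d; rewrite inE.
(* If the joint matrix lacks full column rank, a nonzero column of its cokernel is a vector that it
   kills. *)
apply: contraR M2; rewrite -cokermx_eq0 => /matrix0Pn[i [j cij]].
set W := row_mx _ _ in cij.
apply/bigcupP; exists (x, d, col j (cokermx W)); rewrite inE /= ?dn0 /=.
  by apply/cV0Pn; exists i; rewrite mxE.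
by rewrite -/W colE mulmxA mulmx_coker mul0mx.
Qed.

(** * Lifting a set with few progressions to a larger space *)

(* For every d <> 0, the density of progressions of difference d is < (density of S)^3 / B. *)
Definition few_aps (V : finZmodType) (B : nat) (S : {set V}) :=
  forall d : V, d != 0 -> (#|ap_set S d| * #|V| ^ 2 * B < #|S| ^ 3)%N.

Definition ap_free (V : finZmodType) (A : {set V}) :=
  forall x d : V, x \in A -> x + d \in A -> x + d *+ 2 \in A -> d = 0.

Lemma card_row_split (T : finType) (n m : nat) (P : 'rV[T]_n -> 'rV[T]_m -> bool) :
  #|[set z : 'rV[T]_(n + m) | P (lsubmx z) (rsubmx z)]| =
  (\sum_x #|[set y | P x y]|)%N.
Proof.
rewrite -sum1_card (partition_big (@lsubmx T 1 n m) predT) //=.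
apply: eq_bigr => x _; rewrite sum1dep_card.
have row_inj : injective (@row_mx T 1 n m x) by move=> y1 y2 /eq_row_mx[].
rewrite -(card_imset _ row_inj); apply: eq_card => z; rewrite !inE.
apply/andP/imsetP => [[Pz /eqP zx]|[y]].
  by exists (rsubmx z); rewrite ?inE -zx ?hsubmxK.
by rewrite inE => Pxy ->; rewrite row_mxKl row_mxKr.
Qed.

Lemma card_shift (V : finZmodType) (A : {set V}) (e : V) : #|[set x | x + e \in A]| = #|A|.
Proof.
rewrite -(card_imset A (addIr (- e))); apply: eq_card => x; rewrite inE.
by apply/idP/imsetP => [xA|[y yA ->]]; [exists (x + e); rewrite ?addrK|rewrite subrK].
Qed.

Lemma card_andb (T : finType) (b : bool) (P : pred T) :
  #|[set x | b && P x]| = (b * #|[set x | P x]|)%N.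
Proof.
case: b; first by rewrite mul1n.
by rewrite mul0n; apply: eq_card0 => x; rewrite inE.
Qed.

(** With the images of [d2] as shifts, this removes all dependence on [d2] from the progression
    count. *)
Lemma card_box3 (p k : nat) (A : {set 'rV['F_p]_k}) (e1 e2 e3 : 'rV['F_p]_k) :
  #|[set u : 'rV['F_p]_(k + (k + k)) | [&& lsubmx u + e1 \in A,
     lsubmx (rsubmx u) + e2 \in A & rsubmx (rsubmx u) + e3 \in A]]| = (#|A| ^ 3)%N.
Proof.
have sumb (e : 'rV['F_p]_k) : (\sum_x (x + e \in A)%ring = #|A|)%N.
  by rewrite -(card_shift A e) -sum1dep_card [RHS]big_mkcond; apply: eq_bigr => x _; case: ifP.
rewrite (card_row_split (fun (x : 'rV['F_p]_k) (y : 'rV['F_p]_(k + k)) => [&& x + e1 \in A, lsubmx y + e2 \in A & rsubmx y + e3 \in A])).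
under eq_bigr do rewrite card_andb.
rewrite -big_distrl /= sumb (card_row_split (fun x y : 'rV['F_p]_k => (x + e2 \in A) && (y + e3 \in A))).
under eq_bigr do rewrite card_andb card_shift.
by rewrite -big_distrl /= sumb !expnS expn0 muln1.
Qed.

Lemma mulr2n_neq0 (p n : nat) (d : 'rV['F_p]_n) : prime p -> (2 < p)%N -> d != 0 -> d *+ 2 != 0.
Proof.
move=> pr p2 dn0; rewrite -scaler_nat scaler_eq0 negb_or dn0 andbT.
rewrite -(dvdn_pcharf (pchar_Fp pr)); apply/negP => /dvdn_leq; lia.
Qed.

(** The first three size conditions are those of [exists_maps]. The last one handles differences
    with [d1 = 0]: fewer than [4 * J] fibres, each of relative density [#|A| / p ^ k], must stay
    below the allowed number of progressions. *)
Lemma lift_few_aps (p n m k J B : nat) (S : {set 'rV['F_p]_n}) (A : {set 'rV['F_p]_k}) :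
  prime p -> (2 < p)%N -> (0 < n)%N -> (0 < B)%N -> few_aps B S -> ap_free A ->
  (#|S| <= J * p ^ k)%N -> (2 * p ^ m < 4 ^ J)%N ->
  (2 * (p ^ n) ^ 2 * (p ^ k) ^ 3 < p ^ m)%N ->
  (4 * J * (p ^ n) ^ 2 * B * (p ^ k) ^ 2 <= #|S| ^ 3 * #|A| ^ 2)%N ->
  exists S' : {set 'rV['F_p]_(n + m)},
    few_aps B S' /\ (#|S'| * p ^ k = #|S| * #|A| * p ^ m)%N.
Proof.
move=> pr p2 n0 B0 fewS freeA sJ mJ Nm big.
have cardV r : #|{: 'rV['F_p]_r}| = (p ^ r)%N by rewrite card_mx card_Fp // mul1n.
have K0 : (0 < p ^ k)%N by rewrite expn_gt0 prime_gt0.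
have N0 : (0 < p ^ n)%N by rewrite expn_gt0 prime_gt0.
have P0 : (0 < p ^ m)%N by rewrite expn_gt0 prime_gt0.
have J0 : (0 < J)%N by move: mJ; case: (J) => //; rewrite expn0; lia.
have sa0 : (0 < #|S| ^ 3 * #|A| ^ 2)%N.
  by apply: leq_trans big; rewrite !muln_gt0 J0 B0 K0 N0.
have [s0 a0] : (0 < #|S|)%N /\ (0 < #|A|)%N.
  by move: sa0; rewrite muln_gt0 !expn_gt0 /= !orbF => /andP.
have [M [Mz Mfull]] := @exists_maps p m k J _ S pr (fun d => @mulr2n_neq0 p n d pr p2) sJ mJ
  (eq_ind_r (fun N => 2 * N ^ 2 * _ < _)%N Nm (cardV n)).
(* The upper part of a left inverse of the joint matrix is a left inverse of [M x]; [0 < n] supplies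
   the nonzero [d]. *)
have full1 x : row_full (M x).
  have [d dn0] : exists d : 'rV['F_p]_n, d != 0.
    by exists (const_mx 1); apply/rV0Pn; exists (Ordinal n0); rewrite mxE oner_eq0.
  have [N NM] := row_fullP (Mfull x d dn0).
  apply/row_fullP; exists (usubmx N).
  have /(congr1 ulsubmx) := NM.
  by rewrite -[N in LHS]vsubmxK mul_col_row ?block_mxKul; rewrite scalar_mx_block block_mxKul.
pose S' := [set z : 'rV['F_p]_(n + m) | (lsubmx z \in S) && (rsubmx z *m M (lsubmx z) \in A)].
have fibre x : (#|[set y | y *m M x \in A]| * p ^ k = p ^ m * #|A|)%N.
  exact: card_preim_mulmx.
have cardS' : (#|S'| * p ^ k = #|S| * #|A| * p ^ m)%N.
  rewrite (card_row_split (fun x y => (x \in S) && (y *m M x \in A))) big_distrl /=.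
  under eq_bigr do rewrite card_andb -mulnA fibre.
  rewrite -big_distrl /= -mulnA (mulnC #|A|); congr (_ * _)%N.
  by rewrite -sum1_card [RHS]big_mkcond; apply: eq_bigr => x _; case: ifP.
exists S'; split=> // d dn0; rewrite cardV expnD.
pose d1 := lsubmx d; pose d2 := rsubmx d.
pose Q (x : 'rV['F_p]_n) (y : 'rV['F_p]_m) := [&& y *m M x \in A,
    (y + d2) *m M (x + d1) \in A & (y + d2 *+ 2) *m M (x + d1 *+ 2) \in A].
have apE : #|ap_set S' d| = (\sum_x (x \in ap_set S d1) * #|[set y | Q x y]|)%N.
  under eq_bigr do rewrite -card_andb.
  rewrite -(card_row_split (fun x y => (x \in ap_set S d1) && Q x y)).
  apply: eq_card => z; rewrite /Q !inE !linearD /= -/d1 -/d2.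
  by do 3!case: (_ \in S) => //=; rewrite ?andbF.
have K30 : (0 < (p ^ k) ^ 3)%N by rewrite expn_gt0 K0.
rewrite -(@ltn_pmul2r ((p ^ k) ^ 3)%N) // -[ltnRHS]expnMn cardS'.
have [d10|d1n0] := eqVneq d1 0; last first.
  (* The joint map at the three points is onto, so a given [x] admits exactly a fraction
     [(#|A| / p ^ k) ^ 3] of all [y], whatever [d2] is. *)
  have E : (#|ap_set S' d| * (p ^ k) ^ 3 = #|ap_set S d1| * (p ^ m * #|A| ^ 3))%N.
    rewrite apE big_distrl /= -[in RHS]sum1_card big_distrl /= [RHS]big_mkcond; apply: eq_bigr => x _.
    case: (x \in ap_set S d1); rewrite ?mul0n // !mul1n.
    rewrite -(card_box3 A 0 (d2 *m M (x + d1)) (d2 *+ 2 *m M (x + d1 *+ 2))).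
    have -> : ((p ^ k) ^ 3 = p ^ (k + (k + k)))%N by rewrite -expnM; congr (_ ^ _)%N; lia.
    rewrite -(card_preim_mulmx pr _ (Mfull x d1 d1n0)).
    congr (_ * _)%N; apply: eq_card => y; rewrite !inE !mul_mx_row !row_mxKl !row_mxKr row_mxKl addr0.
    by rewrite /Q !mulmxDl.
  have := fewS d1 d1n0; rewrite cardV.
  move: E; set x' := #|ap_set S' d|; set x := #|ap_set S d1|; set s := #|S|; set a := #|A|.
  set N := (p ^ n)%N; set K3 := ((p ^ k) ^ 3)%N; set P := (p ^ m)%N => E xs.
  have -> : (x' * (N * P) ^ 2 * B * K3 = (x' * K3) * (N ^ 2 * B) * P ^ 2)%N by rewrite expnMn; lia.
  rewrite E.
  have -> : (x * (P * a ^ 3) * (N ^ 2 * B) * P ^ 2 = (x * N ^ 2 * B) * (a ^ 3 * P ^ 3))%N by rewrite !expnS; lia.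
  have -> : ((s * a * P) ^ 3 = s ^ 3 * (a ^ 3 * P ^ 3))%N by rewrite !expnMn mulnA.
  by rewrite ltn_pmul2r // muln_gt0 !(expn_gt0 _ 3) a0 P0.
have d2n0 : d2 != 0.
  by apply: contra dn0 => /eqP d20; rewrite -(hsubmxK d) -/d1 -/d2 d10 d20 row_mx0.
(* All three points lie over the same [x]. If [d2 *m M x] is nonzero, their images would be a
   nontrivial progression in [A], so the fibre contributes nothing; otherwise it contributes at most
   its size. *)
have le : (#|ap_set S' d| * p ^ k <= #|[set x in S | d2 *m M x == 0%ring]| * (p ^ m * #|A|))%N.
  rewrite apE big_distrl /= -[in leqRHS]sum1_card big_distrl /= [leqRHS]big_mkcond; apply: leq_sum => x _.
  have QE y : Q x y = [&& y *m M x \in A, (y + d2) *m M x \in A & (y + d2 *+ 2) *m M x \in A].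
    by rewrite /Q d10 mul0rn !addr0.
  have [xS|xS] := boolP (x \in ap_set S d1); last by rewrite mul0n.
  rewrite !inE; have -> : x \in S by move: xS; rewrite inE => /andP[].
  rewrite -[nat_of_bool true]/1%N !mul1n; have [d2M|d2M] := eqVneq (d2 *m M x) 0.
    rewrite /= -(fibre x); apply: leq_mul => //; apply/subset_leq_card/subsetP => y.
    by rewrite !inE => /andP[].
  rewrite eq_card0 ?mul0n // => y; rewrite !inE QE; apply: contraNF d2M => /and3P[y0 y1 y2].
  apply/eqP/(freeA (y *m M x)) => //; first by rewrite -mulmxDl.
  by rewrite mulr2n -!mulmxDl -mulr2n.
have := Mz d2 d2n0; move: le big.
set x' := #|ap_set S' d|; set z := #|[set x in S | _]|; set s := #|S|; set a := #|A|.
set N := (p ^ n)%N; set K := (p ^ k)%N; set P := (p ^ m)%N => le big zJ.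
have -> : (x' * (N * P) ^ 2 * B * K ^ 3 = (x' * K) * (N ^ 2 * B * K ^ 2) * P ^ 2)%N by rewrite expnMn !expnS; lia.
apply: leq_ltn_trans (_ : (z * (P * a) * (N ^ 2 * B * K ^ 2) * P ^ 2 < _)%N).
  by rewrite !leq_mul2r le !orbT.
have -> : (z * (P * a) * (N ^ 2 * B * K ^ 2) * P ^ 2 = z * (N ^ 2 * B * K ^ 2) * (a * P ^ 3))%N by rewrite !expnS; lia.
have -> : ((s * a * P) ^ 3 = (s ^ 3 * a ^ 2) * (a * P ^ 3))%N by rewrite !expnMn !expnS; lia.
rewrite ltn_pmul2r; last by rewrite muln_gt0 (expn_gt0 _ 3) a0 P0.
apply: leq_trans big; rewrite -!mulnA !(mulnA 4 J) ltn_pmul2r //.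
by rewrite !muln_gt0 N0 K0 B0.
Qed.

(** * Behrend's progression-free sets *)

Lemma natr_Fp (p : nat) (x : 'F_p) : (nat_of_ord x)%:R = x.
Proof. exact: natr_Zp. Qed.

(* Behrend's sphere: digits at most (p-1)/2 add without carries, and a line meets a sphere at most twice. *)
Lemma exists_ap_free (p k : nat) : prime p -> (2 < p)%N -> (0 < k)%N ->
  exists A : {set 'rV['F_p]_k}, ap_free A /\ (p.+1./2 ^ k <= #|A| * (k * p ^ 2))%N.
Proof.
move=> pr p2 k0; set h := p.+1./2.
have hp : (2 * h <= p.+1)%N by have := odd_double_half p.+1; rewrite -mul2n; lia.
have p0 : (0 < p)%N by lia.
have nocarry a b : (a < h -> b < h -> a + b < p)%N by move=> *; lia.
pose dig (x : 'rV['F_p]_k) i : nat := nat_of_ord (x 0 i).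
have dig_lt x i : (dig x i < p)%N by have := ltn_ord (x 0 i); rewrite [in X in _ -> X](esym (Fp_cast pr)).
pose Q x := (\sum_i dig x i ^ 2)%N.
have Qlt x : (Q x < k * p ^ 2)%N.
  apply: leq_ltn_trans (_ : (\sum_(i < k) (p ^ 2).-1 < _)%N).
    apply: leq_sum => i _; rewrite -ltnS prednK ?expn_gt0 ?p0 // ltn_exp2r //.
  by rewrite sum_nat_const card_ord ltn_pmul2l // prednK ?expn_gt0 ?p0.
pose D := [set x : 'rV['F_p]_k | [forall i, dig x i < h]%N].
have cardD : (h ^ k <= #|D|)%N.
  pose F (f : {ffun 'I_k -> 'I_h}) : 'rV['F_p]_k := \row_i (nat_of_ord (f i))%:R.
  have digF f i : dig (F f) i = f i.
    by rewrite /dig mxE val_Fp_nat // modn_small //; have := ltn_ord (f i); lia.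
  have Finj : injective F.
    by move=> f g fg; apply/ffunP => i; apply/val_inj; rewrite /= -!digF fg.
  have -> : (h ^ k = #|[set F f | f in setT]|)%N.
    by rewrite card_imset // cardsT card_ffun !card_ord.
  apply/subset_leq_card/subsetP => _ /imsetP[f _ ->].
  by rewrite inE; apply/forallP => i; rewrite digF.
(* Pigeonhole over the [k * p ^ 2] possible squared radii. In the contrary case every class falls
   short by at least one, hence the successor in the sum below. *)
have [r hr] : exists r : 'I_(k * p ^ 2), (h ^ k <= #|[set x in D | Q x == r]| * (k * p ^ 2))%N.
  apply/existsP; rewrite -[X in is_true X]negbK negb_exists; apply/negP => /forallP none.
  have : (#|D| * (k * p ^ 2) < h ^ k * (k * p ^ 2))%N; last by rewrite ltn_pmul2r ?muln_gt0 ?k0 ?expn_gt0 ?p0 // ltnNge cardD.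
  rewrite -sum1_card (partition_big (fun x => Ordinal (Qlt x)) predT) //=.
  rewrite big_distrl /= [X in (_ < X)%N](_ : _ = \sum_(i < k * p ^ 2) h ^ k)%N; last first.
    by rewrite sum_nat_const card_ord mulnC.
  apply: leq_trans (_ : (\sum_(i < k * p ^ 2) (#|[set x in D | Q x == i]| * (k * p ^ 2)).+1 <= _)%N); last first.
    by apply: leq_sum => i _; rewrite ltnNge; apply: none.
  under [leqRHS]eq_bigr do rewrite -addn1.
  rewrite big_split /= sum1_card card_ord -addn1 leq_add //; last by rewrite muln_gt0 k0 expn_gt0 p0.
  by apply/eq_leq/eq_bigr => i _; rewrite sum1dep_card; congr (_ * _)%N; apply: eq_card => x; rewrite !inE.
exists [set x in D | Q x == r]; split => // x d; pose y := x + d; pose z := x + d *+ 2; rewrite -/y -/z.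
rewrite !inE => /andP[/forallP xD /eqP xr] /andP[/forallP yD /eqP yr] /andP[/forallP zD /eqP zr].
have mid i : (dig x i + dig z i = 2 * dig y i)%N.
  have e : (dig x i + dig z i)%:R = (2 * dig y i)%:R :> 'F_p.
    rewrite natrD natrM !natr_Fp !mxE mulr2n mulrDl !mul1r; ring.
  have := congr1 (@nat_of_ord _) e.
  by rewrite !val_Fp_nat // !modn_small // ?mul2n -?addnn; apply: nocarry.
(* [2 * b = a + c] gives [2 * b ^ 2 <= a ^ 2 + c ^ 2], with equality only for [a = c]. Equal radii
   force equality in the sum, hence in every coordinate. *)
have : (\sum_i (2 * dig y i ^ 2) <= \sum_i (dig x i ^ 2 + dig z i ^ 2) ?= iff [forall (i | true), dig x i == dig y i])%N.
  apply: leqif_sum => i _; have := mid i.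
  move: (dig x i) (dig y i) (dig z i) => a b c abc.
  have [le eqac] := nat_Cauchy a c.
  have sq : (4 * b ^ 2 = a ^ 2 + c ^ 2 + 2 * (a * c))%N.
    by rewrite -[4%N]/(2 ^ 2)%N -expnMn -abc sqrnD.
  split; first lia.
  apply/eqP/eqP => [e|ab]; last by rewrite (_ : c = b) ?ab ?mul2n ?addnn //; lia.
  have : a == c by rewrite -eqac; apply/eqP; lia.
  by move/eqP; lia.
have -> : (\sum_i (2 * dig y i ^ 2) = 2 * Q y)%N by rewrite big_distrr.
have -> : (\sum_i (dig x i ^ 2 + dig z i ^ 2) = Q x + Q z)%N by rewrite big_split.
case=> _; rewrite xr yr zr mul2n -addnn eqxx => /esym/forallP all.
apply: (addrI x); rewrite addr0 -/y; apply/rowP => i.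
by rewrite -[LHS]natr_Fp -[RHS]natr_Fp; move/eqP: (all i); rewrite /dig => ->.
Qed.

End Counting.

(** * Base set and single lifting step, with integer bounds on dimension and density *)

Section Densities.
Import ring.

(** [e] bounds the base 2 logarithm of the inverse density. A lower bound on the density is enough,
    since a denser set can be scaled down. *)
Definition sparse_aps_dim (p B n e : nat) :=
  exists S : {set 'rV['F_p]_n}, few_aps B S /\ (p ^ n <= #|S| * 2 ^ e)%N.

(* The base step uses n : k = 108 : 84 = 9 : 7. At p = 19 it needs k/n in the narrow window
   (0.7730, 0.7820), and 7/9 lies in it; for p = 17 the window is empty. *)
Lemma prime_half_powers (p : nat) : prime p -> 19 <= p ->
  2 * p ^ 84 <= (p.+1./2) ^ 108 /\ 2 * p ^ 300 <= (p.+1./2) ^ 384.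
Proof.
move=> pr p19; have := odd_double_half p.+1; rewrite -mul2n; set h := p.+1./2 => hE.
have hp : p <= 2 * h by lia.
have [p25|p25] := leqP 25 p; last first.
  suff [[-> ->]|[-> ->]] : p = 19 /\ h = 10 \/ p = 23 /\ h = 12 by split; lia.
  have : p \in [:: 19; 20; 21; 22; 23; 24] by rewrite !inE; lia.
  rewrite !inE => /or4P[|||/or3P[]] /eqP e; move: pr; rewrite e // => _; move: hE; rewrite e /=; lia.
(* Since [2 * h >= p >= 25], [(2 * h) ^ (a + b) >= p ^ a * 25 ^ b], which leaves a purely numerical
   condition. The primes 19 and 23 are checked directly above. *)
have reduce a b : 2 * 2 ^ (a + b) <= 25 ^ b -> 2 * p ^ a <= h ^ (a + b).
  move=> ab; rewrite -(@leq_pmul2l (2 ^ (a + b))) ?expn_gt0 // -expnMn.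
  apply: leq_trans (_ : p ^ (a + b) <= _); last by case: (a + b) => // c; rewrite leq_exp2r.
  rewrite [p ^ (a + b)]expnD mulnA [_ * 2]mulnC mulnC leq_mul2l; apply/orP; right.
  by apply: leq_trans ab _; case: (b) => // c; rewrite leq_exp2r.
by split; [apply: (reduce 84 24) | apply: (reduce 300 84)]; lia.
Qed.

(** [J] is the floor of [#|S| / p ^ k] plus one, so [J * p ^ k] lies between [#|S|] and [2 * #|S|]
    and [J] disappears from the conditions. The bound [p * m < J] suffices because
    [p ^ m <= 2 ^ (p * m)]. *)
Lemma lift_by_floor (p n m k B : nat) (S : {set 'rV['F_p]_n}) (A : {set 'rV['F_p]_k}) :
  prime p -> (2 < p) -> (0 < n) -> (0 < B) -> few_aps B S -> ap_free A ->
  0 < m -> p ^ k * (p * m) <= #|S| -> 2 * n + 3 * k < m ->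
  8 * (p ^ n) ^ 2 * B * p ^ k <= #|S| ^ 2 * #|A| ^ 2 ->
  exists S' : {set 'rV['F_p]_(n + m)},
    few_aps B S' /\ (#|S'| * p ^ k = #|S| * #|A| * p ^ m)%N.
Proof.
move=> pr p2 n0 B0 fewS freeA m0 sm mnk big.
have p0 := prime_gt0 pr; have K0 : 0 < p ^ k by rewrite expn_gt0 p0.
pose J := (#|S| %/ p ^ k).+1.
have pmJ : p * m < J by rewrite ltnS leq_divRL // mulnC.
have le2J : J * p ^ k <= 2 * #|S|.
  rewrite [J * _]mulSn mul2n -addnn leq_add // ?leq_trunc_div //.
  by apply: leq_trans sm; rewrite leq_pmulr // muln_gt0 p0.
apply: (@lift_few_aps p n m k J B S A) => //.
- by apply: ltnW; exact: ltn_ceil.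
- have pm : p ^ m <= 2 ^ (p * m).
    by rewrite expnM leq_exp2r // ltnW // ltn_expl.
  have : 2 ^ (p * m) < 2 ^ J by rewrite ltn_exp2l.
  have : 2 <= 2 ^ J by rewrite -[X in X <= _]expn1 leq_exp2l.
  have -> : 4 ^ J = 2 ^ J * 2 ^ J by rewrite -expnMn.
  by move: pm; move: (p ^ m) (2 ^ J) (2 ^ (p * m)) => a b c; nia.
- rewrite -mulnA -!expnM -expnD; apply: leq_trans (_ : p ^ (n * 2 + k * 3).+1 <= _).
    by rewrite expnS ltn_pmul2r ?expn_gt0 ?p0.
  by rewrite leq_exp2l; lia.
- have -> : 4 * J * (p ^ n) ^ 2 * B * (p ^ k) ^ 2 = (J * p ^ k) * (4 * (p ^ n) ^ 2 * B * p ^ k).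
    by rewrite -(mulnn (p ^ k)); lia.
  apply: leq_trans (_ : 2 * #|S| * (4 * (p ^ n) ^ 2 * B * p ^ k) <= _); first by rewrite leq_mul2r le2J orbT.
  have -> : 2 * #|S| * (4 * (p ^ n) ^ 2 * B * p ^ k) = #|S| * (8 * (p ^ n) ^ 2 * B * p ^ k) by lia.
  by rewrite (expnS #|S| 2) -[leqRHS]mulnA leq_mul2l big orbT.
Qed.

Lemma half_pow_ge (p k : nat) : p ^ k <= 2 ^ k * p.+1./2 ^ k.
Proof.
rewrite -expnMn; case: k => // k; rewrite leq_exp2r //.
by have := odd_double_half p.+1; rewrite -mul2n; lia.
Qed.

(** The lift uses [k = 2 * j]. Restricting digits costs density [2 ^ (2 * j)] and the sphere at most
    another [2 ^ j], hence [3 * j]. The exponent [g] is chosen so that [p ^ k * p * p ^ g <= #|S|],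
    after bounding [2 ^ e] by [p ^ e]. *)
Lemma sparse_aps_step (p n e j v : nat) (g := n - e - 2 * j - 1) :
  prime p -> 2 < p -> 0 < j -> sparse_aps_dim p (2 ^ v) n e ->
  2 * j * p ^ 2 <= 2 ^ j -> 2 ^ (3 + v + 2 * e + 6 * j) <= p ^ (2 * j) ->
  e + 2 * j + 1 <= n -> 2 * n + 6 * j < p ^ g ->
  sparse_aps_dim p (2 ^ v) (n + p ^ g) (e + 3 * j).
Proof.
move=> pr p2 j0 [S [fewS dS]] jp big en ng.
have p0 := prime_gt0 pr; have k0 : 0 < 2 * j by lia.
have [A [freeA dA]] := @exists_ap_free p (2 * j) pr p2 k0.
have KA : p ^ (2 * j) <= #|A| * 2 ^ (3 * j).
  apply: leq_trans (half_pow_ge _ _) _.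
  have -> : 2 ^ (3 * j) = 2 ^ (2 * j) * 2 ^ j by rewrite -expnD; congr (_ ^ _); lia.
  rewrite [leqRHS]mulnCA leq_mul2l; apply/orP; right.
  by apply: leq_trans dA _; rewrite leq_mul2l jp orbT.
have e2 : 0 < 2 ^ e by rewrite expn_gt0.
have nE : n = g.+1 + 2 * j + e by rewrite /g; lia.
have sm : p ^ (2 * j) * (p * p ^ g) <= #|S|.
  rewrite -(@leq_pmul2r (2 ^ e)) //; apply: leq_trans dS.
  rewrite {1}nE !expnD [p ^ g.+1]expnS [_ * (p * _)]mulnC leq_mul2l; apply/orP; right.
  by case: (e) => // e'; rewrite leq_exp2r // ltnW.
have [|||||S' [fewS' cS']] := @lift_by_floor p n (p ^ g) (2 * j) (2 ^ v) S A pr p2 _ _ fewS freeA _ sm.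
- lia.
- by rewrite expn_gt0.
- by rewrite expn_gt0 p0.
- by lia.
- rewrite -(@leq_pmul2r (2 ^ (2 * e + 6 * j))) ?expn_gt0 //.
  have dd : (p ^ n) ^ 2 * (p ^ (2 * j)) ^ 2 <= (#|S| * 2 ^ e) ^ 2 * (#|A| * 2 ^ (3 * j)) ^ 2.
    by rewrite leq_mul // leq_exp2r.
  have -> : #|S| ^ 2 * #|A| ^ 2 * 2 ^ (2 * e + 6 * j) = (#|S| * 2 ^ e) ^ 2 * (#|A| * 2 ^ (3 * j)) ^ 2.
    by rewrite !expnMn -!expnM mulnACA -expnD; congr (_ * _ * 2 ^ _); lia.
  apply: leq_trans dd.
  have E : 2 ^ (3 + v + 2 * e + 6 * j) = 8 * 2 ^ v * 2 ^ (2 * e + 6 * j) by rewrite -addnA !expnD.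
  move: big; rewrite E; move: (p ^ n) (2 ^ v) (p ^ (2 * j)) (2 ^ (2 * e + 6 * j)) => N B K W le.
    have -> : 8 * N ^ 2 * B * K * W = N ^ 2 * K * (8 * B * W) by ring.
    have -> : N ^ 2 * K ^ 2 = N ^ 2 * K * K by ring.
    by rewrite leq_mul2l le orbT.
exists S'; split=> //.
have K0 : 0 < p ^ (2 * j) by rewrite expn_gt0 p0.
rewrite -(@leq_pmul2r (p ^ (2 * j))) // mulnAC cS' expnD (expnD 2).
apply: leq_trans (leq_mul (leq_mul dS (leqnn (p ^ p ^ g))) KA) _.
apply: eq_leq; ring.
Qed.

(** One lift of a Behrend set, with [n = 7 * 108 * v] and [k = 7 * 84 * v]: the factor 2 in
    [prime_half_powers] becomes [2 ^ (7 * v)], which pays for all polynomial losses. Also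
    [1347 = 756 + 588 + 3]: the digit restrictions cost [n + k], the two spheres at most [3 * v]. *)
Lemma sparse_aps_base (p v : nat) : prime p -> 19 <= p -> p ^ 100 <= 2 ^ v ->
  sparse_aps_dim p (2 ^ v) (756 * v + 2 ^ (2 * v)) (1347 * v).
Proof.
move=> pr p19 pv.
have p0 := prime_gt0 pr; have p2 : 2 < p by lia.
have v400 : 400 <= v.
  rewrite -(@leq_exp2l 2) //; apply: leq_trans pv.
  by rewrite (_ : 400 = 4 * 100) // expnM; apply: leq_trans (_ : 16 ^ 100 <= _); rewrite ?leq_exp2r //; lia.
have p_pow r : r <= 100 -> p ^ r <= 2 ^ v by move=> r100; apply: leq_trans pv; rewrite leq_exp2l //; lia.
have v_pow : 756 * v <= 2 ^ v.
  have -> : 2 ^ v = 2 ^ 10 * (2 ^ 10 * 2 ^ (v - 20)) by rewrite -!expnD; congr (_ ^ _); lia.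
  by rewrite leq_mul //; have := ltn_expl (v - 20) (isT : 1 < 2); move: (2 ^ (v - 20)) => d; lia.
have [n nE] : exists n, n = 756 * v by eexists.
have [k kE] : exists k, k = 588 * v by eexists.
have n0 : 0 < n by lia.
have k0 : 0 < k by lia.
rewrite -nE.
pose h := p.+1./2; have h0 : 0 < h by rewrite half_gt0; lia.
have [A0 [free0 d0]] := @exists_ap_free p n pr p2 n0.
have [A [free1 d1]] := @exists_ap_free p k pr p2 k0.
have few0 : few_aps (2 ^ v) A0.
  move=> d dn0; rewrite /ap_set eq_card0; last first.
    by move=> x; rewrite inE; apply: contraNF dn0 => /and3P[x0 x1 x2]; apply/eqP/(free0 x).
  rewrite !mul0n expn_gt0 orbF lt0n; apply: contraTneq d0 => ->.
  by rewrite mul0n -ltnNge expn_gt0 h0.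
have mE : 2 ^ (2 * v) = 2 ^ v * 2 ^ v by rewrite -expnD addnn -mul2n.
move: (2 ^ (2 * v)) mE => m mE.
have w7 : 2 ^ (7 * v) = (2 ^ v) ^ 7 by rewrite mulnC expnM.
have e1347 : 2 ^ (1347 * v) = (2 ^ (7 * v)) ^ 192 * (2 ^ v) ^ 3.
  by rewrite -!expnM -expnD; congr (_ ^ _); lia.
clear pv; move: (2 ^ v) v_pow mE p_pow few0 w7 e1347 => w v_pow mE p_pow few0 w7 e1347.
have w0 : 0 < w by apply: leq_trans v_pow; rewrite -nE.
have nw : n <= w by rewrite nE.
have kn : k <= n by rewrite nE kE leq_mul2r orbT.
have kw := leq_trans kn nw.
have n8 : 8 <= n by rewrite nE; clear -v400; lia.
have K0 : 0 < p ^ k by rewrite expn_gt0 p0.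
have g1 : w ^ 7 * p ^ k <= h ^ n.
  have -> : n = 108 * (7 * v) by rewrite nE mulnA.
  have -> : k = 84 * (7 * v) by rewrite kE mulnA.
  have [h1 _] := prime_half_powers pr p19.
  by rewrite -w7 (expnM p 84) (expnM h 108) -expnMn; case: (7 * v) => // c; rewrite leq_exp2r.
have g2 : w ^ 7 * ((p ^ n) ^ 2 * p ^ k) <= (h ^ n) ^ 2 * (h ^ k) ^ 2.
  have -> : (p ^ n) ^ 2 * p ^ k = p ^ (300 * (7 * v)) by rewrite -expnM -expnD; congr (_ ^ _); clear -nE kE; lia.
  have -> : (h ^ n) ^ 2 * (h ^ k) ^ 2 = h ^ (384 * (7 * v)) by rewrite -!expnM -expnD; congr (_ ^ _); clear -nE kE; lia.
  have [_ h2] := prime_half_powers pr p19.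
  by rewrite -w7 (expnM p 300) (expnM h 384) -expnMn; case: (7 * v) => // c; rewrite leq_exp2r.
have sm : p ^ k * (p * m) <= #|A0|.
  have : n * p ^ 2 * (p * m) <= w ^ 7.
    apply: leq_trans (_ : w * (w * (w * w)) <= _).
      rewrite -mulnA leq_mul // mulnA leq_mul ?mE //.
      by rewrite -expnSr p_pow.
    by have -> : w * (w * (w * w)) = w ^ 4 by []; rewrite leq_pexp2l.
  move: d0 g1; have : 0 < n * p ^ 2 by rewrite muln_gt0 n0 expn_gt0 p0.
  move: (n * p ^ 2) (p * m) (p ^ k) (h ^ n) (w ^ 7) => a b c d e a0 d0 g1 ab.
  rewrite -(@leq_pmul2r a) //; apply: leq_trans d0; apply: leq_trans g1.
  by rewrite -mulnA [c * _]mulnC leq_mul2r mulnC ab orbT.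
have [|||S' [fewS' cS']] := @lift_by_floor p n m k w A0 A pr p2 n0 w0 few0 free1 _ sm.
- by rewrite mE muln_gt0 w0.
- rewrite mE; apply: leq_trans (_ : 2 * n + 3 * n < _).
    by rewrite ltnS leq_add2l leq_mul2l kn.
  by apply: leq_trans (leq_mul nw nw); rewrite -mulnDl ltn_pmul2r // nE; clear -v400; lia.
(* All seven factors are spent: [8 * w <= w * w], then [n * k <= w * w] squared, then
   [p ^ 8 <= w]. *)
- have a8 : 8 * w * (n * p ^ 2) ^ 2 * (k * p ^ 2) ^ 2 <= w ^ 7.
    apply: leq_trans (_ : w * w * (w * w) ^ 2 * (p ^ 8) <= _).
      have -> : 8 * w * (n * p ^ 2) ^ 2 * (k * p ^ 2) ^ 2 = 8 * w * (n * k) ^ 2 * p ^ 8 by ring.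
      by rewrite leq_mul2r leq_mul ?orbT // ?leq_mul ?leq_exp2r ?leq_mul // (leq_trans _ nw) // n8.
    have -> : w ^ 7 = w * w * (w * w) ^ 2 * w by ring.
    by rewrite leq_mul2l p_pow ?orbT.
  have d01 : (h ^ n) ^ 2 * (h ^ k) ^ 2 <= (#|A0| * (n * p ^ 2)) ^ 2 * (#|A| * (k * p ^ 2)) ^ 2.
    by rewrite leq_mul // leq_exp2r.
  have np0 : 0 < (n * p ^ 2) ^ 2 * (k * p ^ 2) ^ 2 by rewrite !(muln_gt0, expn_gt0) n0 k0 p0.
  rewrite -(leq_pmul2r np0).
  have -> : #|A0| ^ 2 * #|A| ^ 2 * ((n * p ^ 2) ^ 2 * (k * p ^ 2) ^ 2)
    = (#|A0| * (n * p ^ 2)) ^ 2 * (#|A| * (k * p ^ 2)) ^ 2 by ring.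
  apply: leq_trans d01; apply: leq_trans g2.
  have -> : 8 * (p ^ n) ^ 2 * w * p ^ k * ((n * p ^ 2) ^ 2 * (k * p ^ 2) ^ 2)
    = 8 * w * (n * p ^ 2) ^ 2 * (k * p ^ 2) ^ 2 * ((p ^ n) ^ 2 * p ^ k) by ring.
  by rewrite leq_mul2r a8 orbT.
exists S'; split=> //.
rewrite -(@leq_pmul2r (p ^ k)) // mulnAC cS' expnD.
have -> : p ^ n * p ^ m * p ^ k = p ^ (n + k) * p ^ m by rewrite expnD mulnAC.
rewrite [leqRHS]mulnAC leq_mul2r; apply/orP; right.
apply: leq_trans (half_pow_ge _ _) _.
have -> : 2 ^ (n + k) = (w ^ 7) ^ 192.
  by rewrite -w7 -expnM; congr (_ ^ _); clear -nE kE; lia.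
rewrite e1347 w7 -/h expnD; move: ((w ^ 7) ^ 192) => W.
apply: leq_trans (leq_mul (leqnn _) (leq_mul d0 d1)) _.
have -> : W * (#|A0| * (n * p ^ 2) * (#|A| * (k * p ^ 2))) = 
   (#|A0| * #|A|) * (W * (n * k * p ^ 4)) by ring.
rewrite leq_mul2l leq_mul2l (_ : w ^ 3 = w * w * w); last by ring.
by rewrite !leq_mul ?orbT // p_pow.
Qed.

End Densities.

(** * Passage to real logarithms and to functions *)

Section Heights.
Local Open Scope R_scope.

Lemma INR_expn (a b : nat) : INR (a ^ b)%N = INR a ^ b.
Proof. by elim: b => [|b IH] //; rewrite expnS mult_INR IH. Qed.

Lemma INR2 : INR 2 = 2.
Proof. by rewrite /=; lra. Qed.

Lemma INR_leq (a b : nat) : (a <= b)%N <-> INR a <= INR b.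
Proof. by split=> [/leP/le_INR|/INR_le/leP]. Qed.

Lemma ln2_gt0 : 0 < ln 2.
Proof. rewrite -ln_1; apply: ln_increasing; lra. Qed.

Lemma log2K (x : R) : log2 x * ln 2 = ln x.
Proof. by rewrite /log2; field; have := ln2_gt0; lra. Qed.

Lemma exp_le (x y : R) : exp x <= exp y <-> x <= y.
Proof.
split; last by case=> [/exp_increasing|->]; lra.
by case=> [/exp_lt_inv|/exp_inv]; lra.
Qed.

Lemma log2_leq_expn (a b c : nat) : (0 < b)%N ->
  INR c * log2 (INR b) <= INR a <-> (b ^ c <= 2 ^ a)%N.
Proof.
move=> b0; have b0' : 0 < INR b by apply: lt_0_INR; apply/ltP.
have l2 := ln2_gt0.
rewrite INR_leq !INR_expn -!Rpower_pow //; last by rewrite INR2; lra.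
by rewrite INR2 /Rpower exp_le -(log2K (INR b)); split=> le; nra.
Qed.

Lemma log2_geq_expn (a b c : nat) : (0 < b)%N ->
  INR a <= INR c * log2 (INR b) <-> (2 ^ a <= b ^ c)%N.
Proof.
move=> b0; have b0' : 0 < INR b by apply: lt_0_INR; apply/ltP.
have l2 := ln2_gt0.
rewrite INR_leq !INR_expn -!Rpower_pow //; last by rewrite INR2; lra.
by rewrite INR2 /Rpower exp_le -(log2K (INR b)); split=> le; nra.
Qed.

Lemma big_Rplus_indicator (T : finType) (A : {set T}) (c : R) :
  \big[Rplus/0]_(x : T) (if x \in A then c else 0) = INR #|A| * c.
Proof.
rewrite -sum1_card sum1_count.
elim: (index_enum T) => [|x s IH]; first by rewrite big_nil /=; lra.
rewrite big_cons IH /= plus_INR; case: (x \in A) => /=; lra.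
Qed.

Lemma nat_floor (x : R) : 0 <= x -> exists j : nat, j = Z.to_nat (Int_part x) /\ INR j <= x < INR j + 1.
Proof.
move=> x0; exists (Z.to_nat (Int_part x)); split => //.
have [le gt] := base_Int_part x.
have z0 : Z.le Z0 (Int_part x).
  have : IZR (-1) < IZR (Int_part x) by lra.
  by move/lt_IZR; lia.
rewrite INR_IZR_INZ Z2Nat.id //; lra.
Qed.

(** The scaling factor [c] is at most 1 because the density is at least [2 ^ -e >= alpha]. It
    multiplies progression averages by [c ^ 3], turning the cube of the density into [alpha ^ 3],
    and [2 ^ -v <= beta]. *)
Lemma function_of_sparse_set (p n e v : nat) (alpha beta : R) : prime p ->
  sparse_aps_dim p (2 ^ v)%N n e -> 0 < alpha -> alpha * 2 ^ e <= 1 -> 1 <= beta * 2 ^ v ->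
  exists f : 'rV['F_p]_n -> R,
    (forall x, 0 <= f x <= 1) /\ Ex (fun x => f x) = alpha /\
    (forall d : 'rV['F_p]_n, d != GRing.zero ->
      Ex (fun x => f x * f (GRing.add x d) * f (GRing.add x (GRing.natmul d 2))) < beta * alpha ^ 3).
Proof.
move=> pr [S [few dens]] a0 ae bv.
have Ncard : #|{: 'rV['F_p]_n}| = (p ^ n)%N by rewrite card_mx card_Fp // mul1n.
pose N := INR (p ^ n)%N; pose s := INR #|S|.
have N0 : 0 < N by apply: lt_0_INR; apply/ltP; rewrite expn_gt0 prime_gt0.
have e0 : 0 < 2 ^ e by apply: pow_lt; lra.
have v0 : 0 < 2 ^ v by apply: pow_lt; lra.
have dens' : N <= s * 2 ^ e by move/INR_leq: dens; rewrite mult_INR (INR_expn 2) INR2.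
have s0 : 0 < s.
  have [//|s0] : 0 <= s by exact: pos_INR.
  by move: dens'; rewrite -s0 Rmult_0_l; lra.
pose c := alpha * N / s.
have c0 : 0 < c by apply: Rdiv_lt_0_compat => //; apply: Rmult_lt_0_compat.
exists (fun x => if x \in S then c else 0); split; [|split].
- move=> x; case: (x \in S); last by lra.
  split; first lra.
  rewrite /c; apply: (Rmult_le_reg_r s) => //.
  rewrite /Rdiv Rmult_assoc Rinv_l; nra.
- rewrite /Ex Ncard -/N.
  by rewrite big_Rplus_indicator -/s /c; field; lra.
move=> d dn0; rewrite /Ex Ncard -/N.
rewrite (eq_bigr (fun x => if x \in ap_set S d then c ^ 3 else 0)) => [|x _]; last first.
  by rewrite /ap_set inE; case: (x \in S); case: (_ \in S); case: (_ \in S) => /=; ring.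
rewrite big_Rplus_indicator.
have := few d dn0; rewrite Ncard => /ltP/lt_INR; rewrite 2!mult_INR (INR_expn #|S|) (INR_expn (p ^ n)) (INR_expn 2 v) -/s -/N INR2; set q := INR #|_| => lt.
have q0 : 0 <= q by exact: pos_INR.
have -> : q * c ^ 3 / N = (q * N ^ 2) * (alpha ^ 3 / s ^ 3) by rewrite /c; field; lra.
have -> : beta * alpha ^ 3 = (beta * s ^ 3) * (alpha ^ 3 / s ^ 3) by field; lra.
apply: Rmult_lt_compat_r; first by apply: Rdiv_lt_0_compat; apply: pow_lt.
have b0 : 0 < beta by nra.
apply: Rle_lt_trans (_ : beta * (q * N ^ 2 * 2 ^ v) < _); last by apply: Rmult_lt_compat_l.
have qN : 0 <= q * N ^ 2 by apply: Rmult_le_pos => //; apply: pow2_ge_0.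
by rewrite -[X in X <= _]Rmult_1_r; nra.
Qed.

(** * Iteration up the tower *)

Lemma Tow_ge0 (a r : R) (k : nat) : 0 <= r -> 0 <= Tow a k r.
Proof. by move=> r0; case: k => // k /=; apply/Rlt_le/exp_pos. Qed.

Lemma log2_ge_4_2 (p : nat) : (19 <= p)%N -> 42 / 10 <= log2 (INR p).
Proof.
move=> p19; have p0 : (0 < p)%N by lia.
have : INR 21 <= INR 5 * log2 (INR p).
  apply/log2_geq_expn => //; apply: leq_trans (_ : (19 ^ 5 <= _)%N); last by rewrite leq_exp2r.
  by lia.
rewrite /=; lra.
Qed.

Lemma two_mul_sq_le_pow2 (j : nat) : (20 <= j)%N -> ((2 * j) ^ 2 <= 2 ^ j)%N.
Proof.
move=> j20; have := odd_double_half j; set i := j./2 => jE.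
have i10 : (10 <= i)%N by move: jE; rewrite -mul2n; case: odd => /=; lia.
have ji : (2 * j <= 2 ^ i)%N.
  have -> : (2 ^ i = 2 ^ 4 * 2 ^ (i - 4))%N by rewrite -expnD; congr (_ ^ _)%N; lia.
  have := ltn_expl (i - 4) (isT : (1 < 2)%N); rewrite -[(2 ^ 4)%N]/16%N.
  move: (2 ^ (i - 4))%N => d; move: jE; rewrite -mul2n; case: odd => /=; lia.
apply: leq_trans (_ : ((2 ^ i) ^ 2 <= _)%N); first by rewrite leq_exp2r.
by rewrite -expnM leq_exp2l //; move: jE; rewrite -mul2n; case: odd => /=; lia.
Qed.

(** The constant 18 bounds [2 * n + 6 * j = 2 * g + 2 * (e + 5 * j + 1)] once
    [e + 5 * j + 1 <= 8 * g]. *)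
Lemma linear_lt_exp19 (p g : nat) : (19 <= p)%N -> (18 * g < p ^ g)%N.
Proof.
move=> p19; elim: g => [|g IH]; first by rewrite muln0.
rewrite expnS; move: IH; move: (p ^ g)%N => q; nia.
Qed.

(* Each step takes k = 2 j with j = floor (6 u / L), u the current bound on log2 (1 / density); the
   slack 5 U in the dimension absorbs the loss e + 2 j + 1 in the exponent of the next tower level. *)
Lemma sparse_aps_iter (p v i : nat) (r : R) (L := log2 (INR p)) (U := fun i => 1347 * INR v * (1 + 18 / L) ^ i) :
  prime p -> (19 <= p)%N -> (p ^ 100 <= 2 ^ v)%N -> L ^ 2 <= INR v -> 0 < r <= 2 ^ v ->
  exists n e : nat, sparse_aps_dim p (2 ^ v)%N n e /\ INR e <= U i /\
    Tow (INR p) i r + 5 * U i <= INR n.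
Proof.
move=> pr p19 pv Lv [r0 rv].
have p0 : (0 < p)%N by lia.
have L4 : 42 / 10 <= L by exact: log2_ge_4_2.
have v100 : 100 * L <= INR v.
  by move/(log2_leq_expn _ _ p0): pv; rewrite (_ : INR 100 = 100) // INR_IZR_INZ.
have iL : 0 < 18 / L by apply: Rdiv_lt_0_compat; lra.
have U_ge j : 1347 * INR v <= U j.
  rewrite /U -{1}(Rmult_1_r (1347 * INR v)); apply: Rmult_le_compat_l; first lra.
  by apply: pow_R1_Rle; lra.
elim: i => [|i [n [e [sp [eU TU]]]]].
  exists (756 * v + 2 ^ (2 * v))%N, (1347 * v)%N; split; first exact: sparse_aps_base.
  have c1347 : INR 1347 = 1347 by rewrite INR_IZR_INZ.
  split; first by rewrite mult_INR c1347 /U /=; lra.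
  rewrite plus_INR INR_expn INR2.
  have -> : 2 ^ (2 * v)%N = 2 ^ v * 2 ^ v by rewrite mul2n -addnn pow_add.
  have v20 : (20 <= v)%N by apply/INR_leq; rewrite (_ : INR 20 = 20) ?INR_IZR_INZ // -INR_IZR_INZ; lra.
  have := two_mul_sq_le_pow2 v20; rewrite INR_leq (INR_expn (2 * v)) (INR_expn 2) mult_INR INR2.
  have := pos_INR (756 * v); rewrite /U /Tow pow_O.
  move: rv; move: (2 ^ v) (INR (756 * v)%N) => x y rx y0 /= vx.
  (* From [4 * v ^ 2 <= x] and [v >= 100 * L >= 420]. *)
  have vx' : 1680 * INR v <= x by nra.
  have : 1000 * x <= x * x by nra.
  lra.
set T := Tow _ i r in TU; set u := U i in eU TU.
have T0 : 0 <= T by apply: Tow_ge0; lra.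
have u0 := U_ge i; rewrite -/u in u0.
have UE : U i.+1 = u * (1 + 18 / L) by rewrite /u /U /=; ring.
have [j [_ [jle jgt]]] : exists j : nat, j = Z.to_nat (Int_part (6 * u / L)) /\ INR j <= 6 * u / L < INR j + 1.
  by apply: nat_floor; apply: Rmult_le_pos; [lra | apply/Rlt_le/Rinv_0_lt_compat; lra].
have [c3 c5 c6 c8 c20] : [/\ INR 3 = 3, INR 5 = 5, INR 6 = 6, INR 8 = 8 & INR 20 = 20].
  by split; rewrite INR_IZR_INZ.
have L0' : 0 < L by lra.
have L0 : 0 <= L by lra.
have jL1 : INR j * L <= 6 * u.
  have := Rmult_le_compat_r L _ _ L0 jle; rewrite /Rdiv Rmult_assoc Rinv_l; lra.
have jL2 : 6 * u < INR j * L + L.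
  have := Rmult_lt_compat_r L _ _ L0' jgt; rewrite /Rdiv Rmult_assoc Rinv_l; lra.
have j0 := pos_INR j; have e0 := pos_INR e.
have j42 : INR j * (42 / 10) <= 6 * u by nra.
(* Here [L ^ 2 <= v] enters: it makes [j] large compared with [L], so that [p ^ 4 <= 2 ^ j]
   below. *)
have Lsq : 8000 * L * L <= INR j * L + L by simpl in Lv; nra.
have j4L : 10 * L <= INR j by nra.
have j20 : (20 <= j)%N by apply/INR_leq; rewrite c20; lra.
pose g := (n - e - 2 * j - 1)%N.
have en : (e + 2 * j + 1 <= n)%N.
  by apply/INR_leq; rewrite 2!plus_INR mult_INR INR2 /=; lra.
have gE : INR n = INR g + INR e + 2 * INR j + 1.
  have -> : n = (g + e + 2 * j + 1)%N by rewrite /g; lia.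
  by rewrite 3!plus_INR mult_INR INR2 /=; lra.
(* Of the slack [5 * u], [e] takes at most [u] and [2 * j] at most [12 / 4.2 * u], leaving more than
   [1.1 * u]. *)
have gT : T + 11 / 10 * u <= INR g by lra.
have e8g : (e + 5 * j + 1 <= 8 * g)%N.
  by apply/INR_leq; rewrite 2!plus_INR 2!mult_INR c8 c5 /=; lra.
exists (n + p ^ g)%N, (e + 3 * j)%N; split; [|split].
- have p2 : (2 < p)%N by lia.
  have j1 : (0 < j)%N by lia.
  apply: (@sparse_aps_step p n e j v pr p2 j1 sp _ _ en).
  + rewrite -(@leq_exp2r _ _ 2) // (expnMn (2 * j)) -(expnM p 2 2) -[leqRHS]mulnn.
    have p4 : (p ^ 4 <= 2 ^ j)%N by apply/log2_leq_expn => //=; rewrite -/L; lra.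
    by rewrite leq_mul // two_mul_sq_le_pow2.
  (* The constant 6 in [j] is set here: [2 * j * L > 12 * u - 2 * L], while [2 * e + 6 * j <= (2 +
     36 / 4.2) * u < 10.6 * u]. *)
  + apply/log2_geq_expn => //; rewrite -/L 3!plus_INR 3!mult_INR.
    rewrite c6 c3 INR2.
    nra.
  + apply: leq_ltn_trans (linear_lt_exp19 g p19); rewrite -/g.
    have : n = (g + e + 2 * j + 1)%N by rewrite /g; lia.
    by move: e8g => + ->; lia.
- rewrite plus_INR mult_INR UE c3.
  have -> : u * (1 + 18 / L) = u + 3 * (6 * u / L) by field; lra.
  lra.
have P0 : 0 < INR p by apply: lt_0_INR; apply/ltP.
have lnp : 2 <= ln (INR p).
  have p19' : 19 <= INR p.
    by move/INR_leq: p19; rewrite (_ : INR 19 = 19) // INR_IZR_INZ.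
  apply/exp_le; rewrite exp_ln //.
  have -> : exp 2 = exp 1 * exp 1 by rewrite -exp_plus; congr exp; lra.
  by have := exp_le_3; have := exp_pos 1; nra.
rewrite plus_INR INR_expn -Rpower_pow // UE /=.
set M := INR p in P0 lnp *.
have TP : 1 <= Rpower M T.
  by rewrite /Rpower -{1}exp_0; apply/exp_le; nra.
have gP : Rpower M T * Rpower M (11 / 10 * u) <= Rpower M (INR g).
  by rewrite -Rpower_plus /Rpower; apply/exp_le; nra.
(* Each half contributes [exp (11 / 20 * u * ln M) >= 1 + 11 / 10 * u], as [ln M >= 2]. *)
have QP : (1 + 11 / 10 * u) ^ 2 <= Rpower M (11 / 10 * u).
  rewrite (_ : 11 / 10 * u = 11 / 20 * u + 11 / 20 * u); last by lra.
  rewrite Rpower_plus /= Rmult_1_r.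
  have := exp_ineq1_le (11 / 20 * u * ln M); rewrite -/(Rpower M _) => le.
  by apply: Rmult_le_compat; nra.
have u' : u * (1 + 18 / L) <= 6 * u.
  have : 18 / L <= 5.
    by apply: (Rmult_le_reg_r L); [lra | rewrite /Rdiv Rmult_assoc Rinv_l; lra].
  by nra.
have Q30 : 30 * u + 1 <= Rpower M (11 / 10 * u).
  apply: Rle_trans QP; rewrite /= Rmult_1_r; have : 1000 * u <= u * u by nra.
  lra.
move: TP gP Q30 u'; move: (Rpower M T) (Rpower M (INR g)) (Rpower M (11 / 10 * u)) (u * _) => a b c u1 ? ? ? ?.
have n0 := pos_INR n.
(* [a * c >= a + c - 1] turns the surplus factor [c] into additive slack: [c - 1 >= 30 * u], at
   least five times the new bound. *)
have : 0 <= (a - 1) * (c - 1) by apply: Rmult_le_pos; lra.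
lra.
Qed.

(** * Number of steps against final density, and the choice of parameters *)

Lemma pow_le_exp (x : R) (n : nat) : 0 <= x -> (1 + x) ^ n <= exp (INR n * x).
Proof.
move=> x0; elim: n => [|n IH]; first by rewrite Rmult_0_l exp_0; right.
rewrite S_INR Rmult_plus_distr_r Rmult_1_l exp_plus -tech_pow_Rmult Rmult_comm.
by apply: Rmult_le_compat; [apply: pow_le; lra | lra | exact: IH | exact: exp_ineq1_le].
Qed.

(** Source of [1/20] and 132: the growth factor is at most [exp (18 * H / L) <= exp (9/10 * l)], and
    the remaining [exp (l / 10)] exceeds [2 ^ 13], more than the needed [2 * 1347], where
    [v <= 2 * w]. *)
Lemma density_exponent_bound (L w W l : R) (v H : nat) :
  4 <= L -> 1 <= w -> INR v <= w + 1 -> W = w * exp l -> 132 <= l ->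
  INR H <= / 20 * L * l -> 1347 * INR v * (1 + 18 / L) ^ H <= W.
Proof.
move=> L4 w1 vw -> l132 Hl.
have x0 : 0 <= 18 / L by apply/Rlt_le/Rdiv_lt_0_compat; lra.
have le1 : (1 + 18 / L) ^ H <= exp (9 / 10 * l).
  apply: Rle_trans (pow_le_exp H x0) _; apply/exp_le.
  have -> : 9 / 10 * l = / 20 * L * l * (18 / L) by field; lra.
  exact: Rmult_le_compat_r.
have le2 : 8192 <= exp (/ 10 * l).
  apply: Rle_trans (_ : (1 + 1) ^ 13 <= _); first by rewrite /=; lra.
  apply: Rle_trans (@pow_le_exp 1 13 _) _; first lra.
  by apply/exp_le; rewrite INR_IZR_INZ /=; lra.
have -> : l = 9 / 10 * l + / 10 * l by lra.
rewrite exp_plus; move: vw le1 le2 (exp_pos (9 / 10 * l)); have := pos_INR v.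
move: (INR v) (exp (9 / 10 * l)) (exp (/ 10 * l)) (pow _ H) => V a b c V0 Vw ca b0 a0.
apply: Rle_trans (_ : 2694 * w * a <= _).
  apply: Rle_trans (_ : 1347 * V * a <= _); first by apply: Rmult_le_compat_l; lra.
  by apply: Rmult_le_compat_r; lra.
have wa : 0 <= w * a by apply: Rmult_le_pos; lra.
have : 0 <= w * a * (b - 8192) by apply: Rmult_le_pos; lra.
lra.
Qed.

End Heights.

Theorem theorem10 (p : nat) (alpha beta : R) :
  prime p -> (19 <= p)%N ->
  (0 < alpha < 1)%R ->
  (Rpower alpha (exp (-132)) <= beta)%R ->
  (beta <= Rmin (Rpower (INR p) (- log2 (INR p))) (/ (INR p ^ 100)))%R ->
  exists (n : nat) (f : 'rV['F_p]_n -> R),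
    (TowR (INR p)
       (/ 20 * log2 (INR p) * ln (log2 (/ alpha) / log2 (/ beta)))
       (/ beta) <= INR n)%R /\
    (forall x, 0 <= f x <= 1)%R /\
    Ex (fun x => f x) = alpha /\
    (forall d : 'rV['F_p]_n, d != GRing.zero ->
       (Ex (fun x => f x * f (GRing.add x d) * f (GRing.add x (GRing.natmul d 2))) < beta * alpha ^ 3)%R).
Proof.
Local Open Scope R_scope.
move=> pr p19 [a0 a1] ab bmin.
have p0 : (0 < p)%N by lia.
have P0 : 0 < INR p by apply: lt_0_INR; apply/ltP.
have b0 : 0 < beta by apply: Rlt_le_trans ab; exact: exp_pos.
have ln2 := ln2_gt0.
have L4 := log2_ge_4_2 p19.
set L := log2 (INR p) in L4 bmin *.
have LE : ln (INR p) = L * ln 2 by rewrite log2K.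
have ln_le x y : 0 < x -> x <= y -> ln x <= ln y.
  by move=> x0 [xy|->]; [apply/Rlt_le/ln_increasing | lra].
set W := log2 (/ alpha); set w := log2 (/ beta).
have WE : alpha = exp (- (W * ln 2)) by rewrite log2K ln_Rinv // Ropp_involutive exp_ln.
have wE : beta = exp (- (w * ln 2)) by rewrite log2K ln_Rinv // Ropp_involutive exp_ln.
have wL2 : L ^ 2 <= w.
  have : beta <= Rpower (INR p) (- L) by apply: Rle_trans bmin _; exact: Rmin_l.
  by rewrite wE /Rpower LE => /exp_le le; apply: (Rmult_le_reg_r _ _ _ ln2); simpl; lra.
have wL : 100 * L <= w.
  have : beta <= / (INR p ^ 100) by apply: Rle_trans bmin _; exact: Rmin_r.
  rewrite wE -(Rpower_pow 100) // -Rpower_Ropp /Rpower LE => /exp_le le.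
  have c100 : INR 100 = 100 by rewrite INR_IZR_INZ.
  by rewrite c100 in le; apply: (Rmult_le_reg_r _ _ _ ln2); lra.
(* With [alpha = 2 ^ -W] and [beta = 2 ^ -w], the lower bound on [beta] reads
   [w <= exp (-132) * W]. *)
have wW : w * exp 132 <= W.
  have : w <= exp (-132) * W.
    move: ab; rewrite wE /Rpower WE ln_exp => /exp_le le.
    by apply: (Rmult_le_reg_r _ _ _ ln2); lra.
  move=> le; have := Rmult_le_compat_r _ _ _ (Rlt_le _ _ (exp_pos 132)) le.
  by rewrite (Rmult_comm (exp _) W) Rmult_assoc -exp_plus (_ : -132 + 132 = 0) ?exp_0; lra.
have W0 : 0 < W by apply: Rlt_le_trans wW; apply: Rmult_lt_0_compat; [lra|exact: exp_pos].
set l := ln (W / w).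
have WwE : W = w * exp l.
  by rewrite /l exp_ln; [field; lra | apply: Rdiv_lt_0_compat; lra].
have l132 : 132 <= l.
  apply/exp_le; apply: (Rmult_le_reg_l w); lra.
(* [v] is the floor of [w] plus one, so that [2 ^ v >= 1 / beta]. *)
have [v vE] : exists v : nat, w <= INR v <= w + 1.
  have [|v [_ v1]] := @nat_floor w; first lra.
  by exists v.+1; rewrite S_INR; lra.
have two_pow k : 2 ^ k = exp (INR k * ln 2) by rewrite -Rpower_pow //; lra.
have bv : 1 <= beta * 2 ^ v.
  by rewrite wE two_pow -exp_plus -{1}exp_0; apply/exp_le; nra.
have rv : 0 < / beta <= 2 ^ v.
  split; first exact: Rinv_0_lt_compat.
  by apply: (Rmult_le_reg_l beta) => //; rewrite Rinv_r; lra.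
(* The height is nonnegative, so [Z.to_nat] leaves its floor unchanged. *)
have [|H [HE Hh]] := @nat_floor (/ 20 * L * l).
  by apply: Rmult_le_pos; lra.
have [||n [e [sp [eU Tn]]]] := @sparse_aps_iter p v H (/ beta) pr p19 _ _ rv.
- apply/log2_leq_expn => //; rewrite -/L (_ : INR 100 = 100) ?INR_IZR_INZ // -INR_IZR_INZ; lra.
- rewrite -/L; lra.
have UW := @density_exponent_bound L w W l v H ltac:(lra) ltac:(lra) ltac:(lra) WwE l132 ltac:(lra).
have ae : alpha * 2 ^ e <= 1.
  rewrite WE two_pow -exp_plus -exp_0; apply/exp_le.
  have : INR e <= W by apply: Rle_trans eU UW.
  nra.
have [f fP] := function_of_sparse_set pr sp a0 ae bv.
exists n, f; split=> //.
rewrite /TowR -HE; apply: Rle_trans Tn.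
set T := Tow _ _ _.
have : 0 <= 1347 * INR v * (1 + 18 / L) ^ H.
  apply: Rmult_le_pos; first by have := pos_INR v; lra.
  apply: pow_le; have := @Rdiv_lt_0_compat 18 L; lra.
rewrite -/L; lra.
Qed.
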